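(* Let $\beta>0$. Every G-gamma-MID($\beta$) distribution is the limit distribution, as $n\to\infty$, of geometric($\frac1n$)-maxima of i.i.d. gamma-MID($\frac{\beta}{n}$) random variables. That is, let $\psi:\mathbb{R}\to[0,\infty]$ be such that $e^{-\psi}$ is a distribution function on $\mathbb{R}$; for each integer $n\ge 1$ let $X_{n,1},X_{n,2},\ldots$ be i.i.d. with distribution function $(1+\psi(x))^{-\beta/n}$, and let $N_n$ be a geometric($\frac1n$) random variable independent of them. Then the distribution function of $\max(X_{n,1},\ldots,X_{n,N_n})$ converges, as $n\to\infty$, to the distribution function $\dfrac{1}{1+\beta\log(1+\psi(x))}$ of the G-gamma-MID($\beta$) law.
   Context: All distributions are on $\mathbb{R}$; conventions $e^{-\infty}=0$, $1/\infty=0$, $\log\infty=\infty$. For $\psi:\mathbb{R}\to[0,\infty]$ such that $e^{-\psi}$ is a distribution function and $\beta>0$, the gamma-MID($\beta$) law (associated with $\psi$) has distribution function $\dfrac{1}{(1+\psi(x))^{\beta}}$ and the G-gamma-MID($\beta$) law (associated with $\psi$) has distribution function $\dfrac{1}{1+\beta\log(1+\psi(x))}$. A geometric($p$) law is the geometric law on $\{1,2,\ldots\}$ with mean $1/p$, i.e. $P(N=k)=p(1-p)^{k-1}$. A geometric($p$)-max of i.i.d. variables $X_1,X_2,\ldots$ is $\max(X_1,\ldots,X_N)$ with $N$ geometric($p$) independent of the $X_i$. *)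

(* Defs.v *)
From HB Require Import structures.
From mathcomp Require Import all_boot all_order all_algebra finmap.
From mathcomp Require Import all_classical all_reals all_analysis measurable_realfun.

Set Implicit Arguments.
Unset Strict Implicit.
Unset Printing Implicit Defensive.

Import Order.TTheory GRing.Theory Num.Def Num.Theory.
Import numFieldTopology.Exports numFieldNormedType.Exports.

Local Open Scope classical_set_scope.
Local Open Scope ring_scope.

Section distribution_functions.
Context {R : realType}.
Local Open Scope ereal_scope.

(* Distribution functions take values in [\bar R], as the library's [cdf]. *)
Definition distribution_function (F : R -> \bar R) : Prop :=
  exists G : cumulativeBounded (0 : R)%R (1 : R)%R, forall x, F x = (G x)%:E.

(* The operations on [\bar R] satisfy [expeR -oo = 0], [lne +oo = +oo],
   [+oo^-1 = 0] and [+oo `^ b = +oo] for [b > 0]. *)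
Definition gamma_MID (beta : R) (psi : R -> \bar R) (x : R) : \bar R :=
  ((1 + psi x) `^ beta)^-1.

Definition G_gamma_MID (beta : R) (psi : R -> \bar R) (x : R) : \bar R :=
  (1 + beta%:E * lne (1 + psi x))^-1.

End distribution_functions.

Section laws_and_independence.
Context d (T : measurableType d) (R : realType) (P : probability T R).
Local Open Scope ereal_scope.

Definition geometric_law (p : R) (N : {RV P >-> nat}) : Prop :=
  forall k : nat, (0 < k)%N ->
    P (N @^-1` [set k]) = (p * (1 - p) ^+ k.-1)%:E.

Definition mutually_independent (X : nat -> {RV P >-> R}) : Prop :=
  forall (J : {fset nat}) (B : nat -> set R), (forall i, measurable (B i)) ->
    P (\bigcap_(i in [set` J]) X i @^-1` B i) =
    \prod_(i <- J) P (X i @^-1` B i).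

Definition iid_with_cdf (F : R -> \bar R) (X : nat -> {RV P >-> R}) : Prop :=
  mutually_independent X /\ forall i x, cdf (X i) x = F x.

Definition sigma_of (X : nat -> {RV P >-> R}) : set (set T) :=
  <<s \bigcup_i preimage_set_system setT (X i) measurable >>.

Definition independent_of_sequence (N : {RV P >-> nat})
    (X : nat -> {RV P >-> R}) : Prop :=
  forall (B : set nat) (A : set T), measurable B -> sigma_of X A ->
    P (N @^-1` B `&` A) = P (N @^-1` B) * P A.

End laws_and_independence.

Section random_max.
Context d (T : measurableType d) (R : realType) (P : probability T R).
Variables (X : nat -> {RV P >-> R}) (N : {RV P >-> nat}).

(* The sequence is indexed from 0, so the variables X_1, ..., X_N are
   [X 0, ..., X N.-1].  The value [X 0 t] taken when [N t = 0] is junk;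
   that event is null when [N] is geometric on {1, 2, ...}. *)
Definition random_max (t : T) : R :=
  \big[Num.max/X 0%N t]_(i < N t) X i t.

Lemma measurable_random_max : measurable_fun [set: T] random_max.
Proof.
move=> _ B mB; rewrite setTI.
pose M k t := \big[Num.max/X 0%N t]_(i < k) X i t.
have mX i : measurable_fun [set: T] (X i : T -> R).
  by have := @measurable_funP _ _ _ _ setT (X i).
have mM k : measurable_fun [set: T] (M k).
  rewrite /M; elim: (index_enum _) => [|i r IH].
    by under eq_fun do rewrite big_nil; exact: mX.
  under eq_fun do rewrite big_cons.
  by apply: measurable_maxr; [exact: mX|exact: IH].
have -> : random_max @^-1` B =
    \bigcup_k (N @^-1` [set k] `&` M k @^-1` B).
  apply/seteqP; split => t /=.
    by move=> tB; exists (N t).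
  by move=> [k _ [<-]].
apply: bigcupT_measurable => k; apply: measurableI.
  by rewrite -[X in measurable X]setTI; exact: measurable_funP.
by rewrite -[X in measurable X]setTI; exact: mM.
Qed.

HB.instance Definition _ :=
  isMeasurableFun.Build _ _ _ _ random_max measurable_random_max.

End random_max.

(* Main.v *)
From HB Require Import structures.
Require Import Defs.
From mathcomp Require Import all_boot all_order all_algebra finmap.
From mathcomp Require Import all_classical all_reals all_analysis.
From mathcomp Require Import ring.
Import Order.TTheory GRing.Theory Num.Theory.
Import numFieldNormedType.Exports.
Local Open Scope classical_set_scope.
Local Open Scope ring_scope.

(** With [f = F x], the maximum of a geometric([p]) number of i.i.d. variables
    of distribution function [F] is at most [x] with probability
    [E (f ^ N) = p f / (1 - (1 - p) f)]
    ([cdf_random_max_geometric]).  For [p = 1/n] and [f = y ^ (- beta / n)],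
    where [y = 1 + psi x] is finite, this equals
    [1 / (1 + n (y ^ (beta / n) - 1))] ([geometric_pgf_powR]), and
    [n (y ^ (beta / n) - 1) = n (e ^ (beta ln y / n) - 1)] tends to
    [beta ln y], which is the derivative at [0] of [t |-> e ^ (t beta ln y)]
    ([cvg_mulrn_expR_sub1]).  When [psi x = +oo], both sides are [0].

    That the limit is a distribution function follows from writing it as
    [h (e ^ (- psi x))] for the continuous nondecreasing map
    [h u = 1 / (1 + beta ln (1 - ln u))] of [[0, 1]] onto itself, which fixes
    [0] and [1], with [h 0 = 0] ([G_gamma_link],
    [distribution_function_comp]). *)

(** * The limit is a distribution function *)

Lemma cumulativeBounded01_ge0_le1 {R : realType}
    (G : cumulativeBounded (0 : R) (1 : R)) (x : R) : 0 <= G x <= 1.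
Proof.
have ndG := cumulative_is_nondecreasing G.
apply/andP; split.
- apply: (cvgr_to_le (cumulativeNy G)).
  near=> y; apply: ndG; near: y; exact: nbhs_ninfty_le.
- apply: (cvgr_to_ge (cumulativey G)).
  near=> y; apply: ndG; near: y; exact: nbhs_pinfty_ge.
Unshelve. all: by end_near. Qed.

(** Composing a distribution function with a continuous nondecreasing map of
    [[0, 1]] that fixes the endpoints gives a distribution function.  Continuity
    is two-sided on the real line, so [h] also has to be controlled just outside
    of [[0, 1]]. *)
Lemma distribution_function_comp {R : realType} (h : R -> R)
    (G : cumulativeBounded (0 : R) (1 : R)) :
  (forall u v, 0 <= u -> u <= v -> v <= 1 -> h u <= h v) ->
  (forall u, 0 <= u <= 1 -> {for u, continuous h}) ->
  h 0 = 0 -> h 1 = 1 ->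
  distribution_function (fun x => (h (G x))%:E).
Proof.
move=> nd_h cts_h h0 h1.
have G01 := cumulativeBounded01_ge0_le1 G.
have nd : nondecreasing (h \o G).
  move=> x y xy /=; apply: nd_h.
  - by case/andP: (G01 x).
  - exact: cumulative_is_nondecreasing.
  - by case/andP: (G01 y).
have rc : right_continuous (h \o G).
  move=> x.
  exact: (cvg_comp _ _ (cumulative_is_right_continuous G x) (cts_h _ (G01 x))).
have cNy : (h \o G) x @[x --> -oo] --> (0 : R).
  have := cvg_comp _ _ (cumulativeNy G) (cts_h 0 _).
  by rewrite h0; apply; rewrite lexx ler01.
have cy : (h \o G) x @[x --> +oo] --> (1 : R).
  have := cvg_comp _ _ (cumulativey G) (cts_h 1 _).
  by rewrite h1; apply; rewrite lexx ler01.
pose m1 := isCumulative.Build R _ R (h \o G) nd rc.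
pose m2 := isCumulativeBounded.Build R 0 1 (h \o G) cNy cy.
pose H : cumulativeBounded (0 : R) (1 : R) :=
  HB.pack (h \o G) m1 m2.
by exists H.
Qed.

(** The map that turns the distribution function [u = e^-psi] into
    [1 / (1 + beta log (1 + psi))].  At [u = 0], where [psi = +oo], the value is
    the limit [0]; extending by [0] to negative [u] makes the map continuous on
    both sides of [0].  Only the values on [[0, 1]] carry a meaning. *)
Definition G_gamma_link {R : realType} (beta u : R) : R :=
  if u <= 0 then 0 else (1 + beta * ln (1 - ln u))^-1.

Section G_gamma_link.
Context {R : realType} (beta : R).
Hypothesis beta_gt0 : 0 < beta.
Local Notation h := (G_gamma_link beta).

Let denom_ge1 u : u <= 1 -> 1 <= 1 + beta * ln (1 - ln u).
Proof.
move=> u1; rewrite lerDl mulr_ge0 ?(ltW beta_gt0)// ln_ge0//.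
by rewrite lerBrDr gerDl ln_le0.
Qed.

Lemma G_gamma_link0 : h 0 = 0. Proof. by rewrite /G_gamma_link lexx. Qed.

Lemma G_gamma_link1 : h 1 = 1.
Proof. by rewrite /G_gamma_link ler10 ln1 subr0 ln1 mulr0 addr0 invr1. Qed.

Lemma G_gamma_link_nondecreasing u v :
  0 <= u -> u <= v -> v <= 1 -> h u <= h v.
Proof.
move=> u0 uv v1; rewrite /G_gamma_link.
have d0 w : w <= 1 -> 0 < 1 + beta * ln (1 - ln w).
  by move=> /denom_ge1; apply: lt_le_trans.
have := uv; case: (leP v 0) => [v0 uv'|v0 _].
  by rewrite (le_trans uv v0).
case: (leP u 0) => [_|u_gt0]; first by rewrite invr_ge0 ltW// d0.
have u1 := le_trans uv v1.
rewrite lef_pV2 ?posrE ?d0// lerD2l ler_pM2l//.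
have l1 w : w <= 1 -> 0 < 1 - ln w.
  by move=> w1; rewrite subr_gt0 (le_lt_trans _ ltr01)// ln_le0.
by rewrite ler_ln ?posrE ?l1// lerD2l lerN2 ler_ln ?posrE.
Qed.

Lemma G_gamma_link_continuous u : 0 <= u <= 1 -> {for u, continuous h}.
Proof.
case/andP; rewrite le_eqVlt => /predU1P[<- _|u0 u1].
  apply/left_right_continuousP; rewrite G_gamma_link0; split.
    apply: cvg_near_cst; near=> v.
    have v0 : v <= 0 by near: v; exact: nbhs_left_le.
    by rewrite /G_gamma_link v0.
  apply: (@cvg_trans _ ((fun v => (1 + beta * ln (1 - ln v))^-1) @ 0^'+)).
    apply: near_eq_cvg; near=> v.
    have v0 : 0 < v by near: v; exact: nbhs_right_gt.
    by rewrite /G_gamma_link leNgt v0.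
  have cy : (1 + beta * ln (1 - ln v)) @[v --> (0:R)^'+] --> +oo.
    apply/cvgryPge => A; near=> v.
    (* Equivalently, [ln (1 - ln v)] is at least [`|A| / beta]. *)
    have lnv : ln v <= 1 - expR (`|A| / beta).
      near: v; have := @lnNy R; move/cvgrNyPle; exact.
    apply: (@le_trans _ _ (1 + beta * (`|A| / beta))).
      rewrite mulrCA divff ?gt_eqF// mulr1.
      by rewrite (le_trans (ler_norm A))// lerDr.
    rewrite lerD2l ler_pM2l//.
    have e1 : expR (`|A| / beta) <= 1 - ln v by rewrite lerBrDr addrC -lerBrDr.
    by rewrite -ler_expR lnK// posrE (lt_le_trans _ e1)// expR_gt0.
  apply/cvgrVy.
    near=> v.
    have v1 : v <= 1 by near: v; exact: nbhs_right_le.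
    by rewrite invr_gt0 (lt_le_trans ltr01)// denom_ge1.
  apply: cvg_trans cy; apply: near_eq_cvg; near=> v.
  by rewrite [RHS]invrK.
have hu : h u = (1 + beta * ln (1 - ln u))^-1.
  by rewrite /G_gamma_link leNgt u0.
rewrite /prop_for /continuous_at hu.
have l0 : 0 < 1 - ln u by rewrite subr_gt0 (le_lt_trans _ ltr01)// ln_le0.
have d_cvg : 1 + beta * ln (1 - ln v) @[v --> u] --> 1 + beta * ln (1 - ln u).
  apply: cvgD; first exact: cvg_cst.
  apply: cvgM; first exact: cvg_cst.
  have l_cvg : 1 - ln v @[v --> u] --> 1 - ln u.
    by apply: cvgB; [exact: cvg_cst|exact: continuous_ln].
  exact: (cvg_comp _ _ l_cvg (continuous_ln l0)).
have d_neq0 : 1 + beta * ln (1 - ln u) != 0.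
  by rewrite gt_eqF// (lt_le_trans ltr01)// denom_ge1.
apply: cvg_trans (cvgV d_neq0 d_cvg).
apply: near_eq_cvg; near=> v.
have v0 : 0 < v by near: v; exact: lt_nbhsr.
by rewrite /G_gamma_link leNgt v0.
Unshelve. all: by end_near. Qed.

End G_gamma_link.

Lemma G_gamma_MIDE {R : realType} (beta : R) (psi : R -> \bar R) (x g : R) :
  0 < beta -> (0 <= psi x)%E -> expeR (- psi x)%E = g%:E ->
  G_gamma_MID beta psi x = (G_gamma_link beta g)%:E.
Proof.
rewrite /G_gamma_MID /G_gamma_link => b0.
case: (psi x) => [r|_|//]; last first.
  rewrite /= => -[<-]; rewrite lexx gt0_muley ?lte_fin// addey// invey//.
rewrite lee_fin => r0 gE; have {gE}<- : expR (- r) = g by case: gE.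
rewrite (leNgt (expR _)) expR_gt0 expRK opprK.
have y1 : 0 < 1 + r by rewrite (lt_le_trans ltr01)// lerDl.
rewrite -EFinD lne_EFin// -EFinM -EFinD inver gt_eqF//.
by rewrite (lt_le_trans ltr01)// lerDl mulr_ge0 ?(ltW b0)// ln_ge0 ?lerDl.
Qed.

Lemma G_gamma_MID_distribution_function {R : realType} (beta : R)
    (psi : R -> \bar R) :
  0 < beta -> (forall x, 0 <= psi x)%E ->
  distribution_function (fun x => expeR (- psi x)%E) ->
  distribution_function (G_gamma_MID beta psi).
Proof.
move=> b0 psi0 [G psiG].
have -> : G_gamma_MID beta psi = fun x => (G_gamma_link beta (G x))%:E.
  by apply/funext => x; exact: G_gamma_MIDE.
apply: distribution_function_comp.
- exact: G_gamma_link_nondecreasing.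
- exact: G_gamma_link_continuous.
- exact: G_gamma_link0.
- exact: G_gamma_link1.
Qed.

(** * Maxima of geometrically many variables *)

(** The probability generating function of the geometric([p]) law on
    [{1, 2, ...}], evaluated at [f]. *)
Definition geometric_pgf {R : realType} (p f : R) : R :=
  p * f / (1 - (1 - p) * f).

Lemma g_sigma_algebra_bigcap {T : Type} (G : set (set T)) (D : set nat)
    (F : nat -> set T) :
  (forall i, <<s G >> (F i)) -> <<s G >> (\bigcap_(i in D) F i).
Proof.
move=> GF; rewrite -[X in <<s G >> X]setCK setC_bigcap -setTD.
apply: sigma_algebraCD; rewrite bigcup_mkcond; apply: sigma_algebra_bigcup => i.
case: ifP => _; last exact: sigma_algebra0.
by rewrite -setTD; exact: sigma_algebraCD.
Qed.

Section random_max_cdf.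
Context {d} {T : measurableType d} {R : realType} {P : probability T R}.
Local Open Scope ereal_scope.

(** The term of index [0] is a free constant [c]: it stands for the mass at [0],
    which [geometric_law] does not specify. *)
Lemma cvg_geometric_pgf (p f c : R) :
  (0 < p <= 1)%R -> (0 <= f <= 1)%R ->
  (\sum_(0 <= k < n)
     if k is k'.+1 then p * (1 - p) ^+ k' * f ^+ k else c)%R @[n --> \oo] -->
  (c + geometric_pgf p f)%R.
Proof.
move=> /andP[p0 p1] /andP[f0 f1].
have q01 : (`|(1 - p) * f| < 1)%R.
  have q0 : (0 <= 1 - p)%R by rewrite subr_ge0.
  rewrite ger0_norm ?mulr_ge0//.
  by rewrite (le_lt_trans (ler_piMr q0 f1))// ltrBlDr ltrDl.
rewrite -cvg_shiftS /=.
under eq_fun => n.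
  rewrite big_nat_recl//=.
  under eq_bigr => k _ do rewrite exprS mulrACA -exprMn.
  over.
apply: cvgD; first exact: cvg_cst.
by have := @cvg_geometric_series _ (p * f)%R _ q01; rewrite /series/=.
Qed.

(** Total probability over the values of [N].  Keeping the contribution of
    [N = 0] apart allows the lemma to be used for proving that this event is
    null. *)
Lemma probability_geometric_mixture (p f : R) (N : {RV P >-> nat})
    (A : nat -> set T) :
  (0 < p <= 1)%R -> (0 <= f <= 1)%R -> geometric_law p N ->
  (forall k, measurable (A k)) ->
  (forall k, (0 < k)%N ->
     P (N @^-1` [set k] `&` A k) = P (N @^-1` [set k]) * (f ^+ k)%:E) ->
  P (\bigcup_k (N @^-1` [set k] `&` A k)) =
  P (N @^-1` [set 0%N] `&` A 0%N) + (geometric_pgf p f)%:E.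
Proof.
move=> p01 f01 geoN mA PNA.
have mNA k : measurable (N @^-1` [set k] `&` A k).
  apply: measurableI => //.
  by rewrite -[X in measurable X]setTI; exact: measurable_funP.
have tNA : trivIset setT (fun k => N @^-1` [set k] `&` A k).
  by apply/trivIsetP => i j _ _ ij; rewrite -subset0 => t [] /= [-> _] [/eqP];
    rewrite (negbTE ij).
set c := fine (P (N @^-1` [set 0%N] `&` A 0%N)).
have cE : P (N @^-1` [set 0%N] `&` A 0%N) = c%:E.
  by rewrite fineK// fin_num_measure.
rewrite cE -EFinD.
have -> : (c + geometric_pgf p f)%:E = limn (fun n =>
    \sum_(0 <= k < n) P (N @^-1` [set k] `&` A k)).
  apply/esym/cvg_lim => //.
  have sumE n : \sum_(0 <= k < n) P (N @^-1` [set k] `&` A k) =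
    (\sum_(0 <= k < n)
       if k is k'.+1 then p * (1 - p) ^+ k' * f ^+ k else c)%:E.
    rewrite -sumEFin; apply: eq_bigr => -[|k] _; first by [].
    by rewrite PNA// geoN// -EFinM.
  under eq_fun do rewrite sumE.
  apply/fine_cvgP; split; first by near=> n.
  exact: cvg_geometric_pgf.
apply/esym/cvg_lim => //.
exact: measure_sigma_additive.
Unshelve. all: by end_near. Qed.

(** The masses at the positive integers sum to [geometric_pgf p 1 = 1]. *)
Lemma geometric_law_eq0 (p : R) (N : {RV P >-> nat}) :
  (0 < p <= 1)%R -> geometric_law p N -> P (N @^-1` [set 0%N]) = 0.
Proof.
move=> p01 geoN.
have := @probability_geometric_mixture p 1 N (fun=> setT) p01 _ geoN
  (fun=> measurableT) _.
rewrite ler01 lexx setIT => /(_ isT) H.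
have {H} : 1 = P (N @^-1` [set 0%N]) + 1.
  rewrite -[LHS](@probability_setT _ _ _ P).
  have -> : [set: T] = \bigcup_k (N @^-1` [set k] `&` setT).
    by apply/seteqP; split => // t _; exists (N t).
  rewrite H => [|k _]; last by rewrite setIT expr1n mule1.
  congr (_ + _%:E); rewrite /geometric_pgf !mulr1 subKr divff//.
  by rewrite gt_eqF//; case/andP: p01.
by move=> /(congr1 (fun y => y - 1)); rewrite addeK// subee.
Qed.

(** Given [N = k] with [k > 0], the maximum is at most [x] when the first [k]
    variables are, which has probability [F x ^+ k]; averaging over [N] gives
    the generating function of the geometric law at [F x]. *)
Lemma cdf_random_max_geometric (X : nat -> {RV P >-> R}) (N : {RV P >-> nat})
    (F : R -> \bar R) (p : R) (x : R) :
  (0 < p <= 1)%R -> iid_with_cdf F X -> geometric_law p N ->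
  independent_of_sequence N X ->
  cdf (random_max X N : {RV P >-> R}) x = (geometric_pgf p (fine (F x)))%:E.
Proof.
move=> p01 [indX cdfX] geoN indNX.
pose A k := \bigcap_(i in [set i | (i < k)%N]) (X i @^-1` `]-oo, x]).
have XF i : P (X i @^-1` `]-oo, x]) = F x by rewrite -(cdfX i x).
have Ffin : F x = (fine (F x))%:E.
  by rewrite fineK// -(XF 0%N) fin_num_measure//
    -[X in measurable X]setTI; exact: measurable_funP.
have f01 : (0 <= fine (F x) <= 1)%R.
  by rewrite -!lee_fin -Ffin -(cdfX 0%N x) cdf_ge0 cdf_le1.
have sX i : sigma_of X (X i @^-1` `]-oo, x]).
  apply: sub_sigma_algebra; exists i => //.
  by exists `]-oo, x]%classic; [exact: measurable_itv|rewrite setTI].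
have sA k : sigma_of X (A k).
  exact: g_sigma_algebra_bigcap.
have mX i : measurable (X i @^-1` `]-oo, x]).
  by rewrite -[X in measurable X]setTI; exact: measurable_funP.
have mA k : measurable (A k) by exact: bigcap_measurableType.
have PA k : P (A k) = (fine (F x) ^+ k)%:E.
  pose J := seq_fset tt (iota 0 k).
  have JE : [set` J] = [set i | (i < k)%N].
    by apply/seteqP; split => i /=;
      rewrite (perm_mem (seq_fset_perm tt _)) mem_undup mem_iota.
  rewrite /A -JE indX//.
  rewrite (perm_big _ (seq_fset_perm tt (iota 0 k))) undup_id ?iota_uniq//=.
  under eq_bigr do rewrite XF Ffin.
  by rewrite prodEFin big_const_seq count_predT size_iota iter_mulr_1.
have mN B : measurable (N @^-1` B).
  by rewrite -[X in measurable X]setTI; exact: measurable_funP.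
have PN0 := geometric_law_eq0 _ _ p01 geoN.
have PN0A : P (N @^-1` [set 0%N] `&` A 0%N) = 0.
  apply/eqP; rewrite -measure_le0 -PN0.
  by apply: le_measure; rewrite ?inE//; exact: measurableI.
have <- : P (\bigcup_k (N @^-1` [set k] `&` A k)) =
    (geometric_pgf p (fine (F x)))%:E.
  rewrite (@probability_geometric_mixture p (fine (F x)))//.
    by rewrite PN0A add0e.
  by move=> k _; rewrite indNX// PA.
rewrite /cdf /distribution /pushforward.
(* Where [N] vanishes, [A 0] is everything, while the junk value of the maximum
   need not be at most [x]; the two events agree elsewhere. *)
have -> : \bigcup_k (N @^-1` [set k] `&` A k) =
  (random_max X N @^-1` `]-oo, x]) `|` (N @^-1` [set 0%N]).
  apply/seteqP; split => t /=.
    move=> [k _ /= [NtE At]]; rewrite /A/=.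
    have [k0|k0] := posnP k; [by right; rewrite NtE k0|left].
    rewrite in_itv/=; apply/bigmax_leP; rewrite NtE; split; first exact: At.
    by move=> i _; have := At i (ltn_ord i); rewrite /= in_itv.
  move=> [|Nt0]; last by exists 0%N.
  rewrite in_itv/= => /bigmax_leP[_ Mt].
  exists (N t) => //; split => // i /= it.
  by rewrite in_itv/=; exact: (Mt (Ordinal it)).
by rewrite measureU0// -[X in measurable X]setTI; exact: measurable_random_max.
Qed.
End random_max_cdf.

(** * Convergence *)

(** Squeezed between [a] and [a / (1 - a / n)]. *)
Lemma cvg_mulrn_expR_sub1 {R : realType} (a : R) :
  n%:R * (expR (a / n%:R) - 1) @[n --> \oo] --> a.
Proof.
have an0 : a / n%:R @[n --> \oo] --> (0 : R).
  rewrite -cvg_shiftS; have := @cvg_harmonic R.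
  by move=> /(cvgM (cvg_cst a)); rewrite mulr0.
have upper : a / (1 - a / n%:R) @[n --> \oo] --> a.
  have /cvgV : 1 - a / n%:R @[n --> \oo] --> 1 - (0 : R).
    by apply: cvgB => //; exact: cvg_cst.
  by rewrite subr0 oner_eq0 invr1 => /(_ isT)
    /(cvgM (cvg_cst a)); rewrite mulr1.
apply: (squeeze_cvgr _ (cvg_cst a) upper).
near=> n.
have n0 : 0 < n%:R :> R by rewrite ltr0n; near: n; exact: nbhs_infty_gt.
have an1 : 0 < 1 - a / n%:R.
  by rewrite subr_gt0; near: n; exact: (cvgr_lt _ an0).
have nE : n%:R * (a / n%:R) = a by rewrite mulrCA divff ?mulr1// gt_eqF.
apply/andP; split.
  by rewrite -[leLHS]nE ler_pM2l// lerBrDl expR_ge1Dx.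
(* The upper bound comes from [1 - t <= expR (- t)] at [t = a / n]. *)
have -> : a / (1 - a / n%:R) = n%:R * ((1 - a / n%:R)^-1 - 1).
  rewrite -[in X in X / _]nE; move: (a / n%:R) an1 => x x1.
  by field; rewrite gt_eqF.
rewrite ler_pM2l// lerB// -[expR _]invrK lef_pV2 ?posrE ?invr_gt0 ?expR_gt0//.
by rewrite -expRN; have := expR_ge1Dx (- (a / n%:R)).
Unshelve. all: by end_near. Qed.

Lemma geometric_pgf_powR {R : realType} (n : nat) (y b : R) :
  0 < y -> (0 < n)%N ->
  geometric_pgf n%:R^-1 (y `^ (b / n%:R))^-1 =
  (1 + n%:R * (expR (b * ln y / n%:R) - 1))^-1.
Proof.
move=> y0 n0; rewrite /geometric_pgf /powR gt_eqF// (mulrAC b).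
set e := expR _.
have e0 : e != 0 by rewrite gt_eqF ?expR_gt0.
have n_neq0 : n%:R != 0 :> R by rewrite pnatr_eq0 -lt0n.
have -> : 1 - (1 - n%:R^-1) * e^-1 = n%:R^-1 * e^-1 * (1 + n%:R * (e - 1)).
  by field; rewrite e0.
by rewrite -[LHS]invrK invf_div mulrAC divff ?mul1r// mulf_neq0 ?invr_eq0.
Qed.

Lemma gamma_MIDE {R : realType} (b : R) (psi : R -> \bar R) (x : R) :
  0 < b -> (0 <= psi x)%E ->
  gamma_MID b psi x =
  (if psi x is r%:E then ((1 + r) `^ b)^-1 else 0)%:E.
Proof.
rewrite /gamma_MID => b0; case: (psi x) => [r|_|//].
  rewrite lee_fin => r0.
  have y1 : 0 < 1 + r by rewrite (lt_le_trans ltr01)// lerDl.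
  by rewrite -EFinD poweR_EFin inver gt_eqF// powR_gt0.
by rewrite addey// poweRyr ?invey// gt_eqF.
Qed.

Lemma cvg_geometric_pgf_gamma_MID {R : realType} (b : R) (psi : R -> \bar R)
    (x : R) : 0 < b -> (0 <= psi x)%E ->
  (geometric_pgf n%:R^-1 (fine (gamma_MID (b / n%:R) psi x)))%:E @[n --> \oo]
    --> G_gamma_MID b psi x.
Proof.
move=> b0 psi0.
have gE n : (0 < n)%N -> fine (gamma_MID (b / n%:R) psi x) =
    if psi x is r%:E then ((1 + r) `^ (b / n%:R))^-1 else 0.
  by move=> n0; rewrite gamma_MIDE// divr_gt0// ltr0n.
rewrite /G_gamma_MID; case: (psi x) psi0 gE => [r||//] psi0 gE; last first.
  rewrite addey// gt0_muley ?lte_fin// addey// invey.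
  apply: cvg_near_cst; near=> n.
  have n0 : (0 < n)%N by near: n; exact: nbhs_infty_gt.
  by rewrite gE// /geometric_pgf !mulr0 mul0r.
have y1 : 0 < 1 + r by rewrite (lt_le_trans ltr01)// lerDl.
have l0 : 0 <= b * ln (1 + r) by rewrite mulr_ge0 ?(ltW b0)// ln_ge0 ?lerDl.
have d0 : 1 + b * ln (1 + r) != 0.
  by rewrite gt_eqF// (lt_le_trans ltr01)// lerDl.
rewrite -EFinD lne_EFin// -EFinM -EFinD inver (negbTE d0).
have d_cvg : 1 + n%:R * (expR (b * ln (1 + r) / n%:R) - 1) @[n --> \oo] -->
    1 + b * ln (1 + r).
  by apply: cvgD; [exact: cvg_cst|exact: cvg_mulrn_expR_sub1].
apply: cvg_EFin; first by near=> n.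
apply: cvg_trans (cvgV d0 d_cvg).
apply: near_eq_cvg; near=> n.
have n0 : (0 < n)%N by near: n; exact: nbhs_infty_gt.
by rewrite /= gE// geometric_pgf_powR.
Unshelve. all: by end_near. Qed.

Theorem theorem2p3 (R : realType) (beta : R) (psi : R -> \bar R)
  (d : nat -> measure_display) (T : forall n, measurableType (d n))
  (P : forall n, probability (T n) R)
  (X : forall n, nat -> {RV (P n) >-> R})
  (N : forall n, {RV (P n) >-> nat})
  (beta_gt0 : 0 < beta)
  (psi_ge0 : forall x, (0 <= psi x)%E)
  (psi_df : distribution_function (fun x => expeR (- psi x)%E))
  (X_iid : forall n, (0 < n)%N ->
     iid_with_cdf (gamma_MID (beta / n%:R) psi) (X n))
  (N_geometric : forall n, (0 < n)%N -> geometric_law (n%:R^-1) (N n))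
  (NX_independent : forall n, (0 < n)%N -> independent_of_sequence (N n) (X n)) :
  distribution_function (G_gamma_MID beta psi) /\
  forall x : R,
    cdf (random_max (X n) (N n) : {RV (P n) >-> R}) x @[n --> \oo]
      --> G_gamma_MID beta psi x.
Proof.
split; first exact: G_gamma_MID_distribution_function.
move=> x.
apply: cvg_trans (cvg_geometric_pgf_gamma_MID beta psi x beta_gt0 _) => //.
apply: near_eq_cvg; near=> n.
have n0 : (0 < n)%N by near: n; exact: nbhs_infty_gt.
apply/esym/cdf_random_max_geometric.
- by rewrite invr_gt0 ltr0n n0 invf_le1 ?ltr0n// ler1n.
- exact: X_iid.
- exact: N_geometric.
- exact: NX_independent.
Unshelve. all: by end_near. Qed.
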